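(* For a natural number $n\ge 4$, $0<\varepsilon<1/2$ and real $D>1$, put \[ B_1(D)=\frac{1.31}{\pi}\,\varepsilon\, D^{1/2-\varepsilon-\log(2)/W(\log D)},\qquad B_{2,n}(D)=\frac{1.31}{\pi}\,\varepsilon\,\frac{D^{1/2-\varepsilon-1/n}}{f(n)} . \] (i) For every natural number $n\ge 4$ there is an interval of positive length of real numbers $D>1$, not depending on $\varepsilon$, on which $B_{2,n}(D)>B_1(D)$; equivalently, on which \[ \frac{D^{-1/n}}{f(n)}>D^{-\log 2/W(\log D)} . \] (ii) For every fixed natural number $n\ge 4$ there is a real number $D_0=D_0(n)$ such that $B_1(D)>B_{2,n}(D)$ for all $D>D_0$; equivalently, \[ D^{-\log 2/W(\log D)}>\frac{D^{-1/n}}{f(n)}\quad\text{for all } D>D_0 . \]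
   Context: $W(x)$, for $x\ge 0$, is the Lambert function: the inverse function of $w\mapsto w\exp(w)$ on $w\ge 0$. For a natural number $n\ge 4$, \[ f(n) = \exp\big[ ( \pi(2^n) - 1/n ) \log 2 - \theta(2^n)/n\big], \] where $\pi(t)$ is the number of primes $p\le t$ and $\theta(t)=\sum_{p\le t}\log p$ (sum over primes); the $\pi$ in the factor $1.31/\pi$ is the constant $3.14159\ldots$. Here $\log$ is the natural logarithm. $B_1(D)$ and $B_{2,n}(D)$ are two lower bounds for the size $p(-D)$ of the principal genus of discriminant $-D$, compared here as functions of a real variable $D$. *)

(* Defs.v *)
From HB Require Import structures.
From mathcomp Require Import all_boot all_order all_algebra.
From mathcomp Require Import all_classical all_reals all_analysis.

Set Implicit Arguments.
Unset Strict Implicit.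
Unset Printing Implicit Defensive.

Import Order.TTheory GRing.Theory Num.Theory.
Local Open Scope classical_set_scope.
Local Open Scope ring_scope.

Section Definitions.
Variable R : realType.

(* Only the values on [0, +oo[, the image of [0, +oo[ under w |-> w exp(w),
   are meaningful; elsewhere the inverse is set to a default value. *)
Definition lambertW : R -> R :=
  'pinv_(fun=> 0) [set w : R | 0 <= w] (fun w => w * expR w).

(* The prime-counting function and the Chebyshev function theta are needed at
   natural arguments only.  [primepi] is unrelated to the constant [pi]. *)
Definition primepi (m : nat) : nat := (\sum_(p < m.+1 | prime p) 1)%N.

Definition theta (m : nat) : R := \sum_(p < m.+1 | prime p) ln (p%:R).

Definition f (n : nat) : R :=
  expR (((primepi (2 ^ n))%:R - 1 / n%:R) * ln 2 - theta (2 ^ n) / n%:R).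

Definition B1 (eps D : R) : R :=
  131 / 100 / pi * eps * D `^ (1 / 2 - eps - ln 2 / lambertW (ln D)).

Definition B2 (n : nat) (eps D : R) : R :=
  131 / 100 / pi * eps * (D `^ (1 / 2 - eps - 1 / n%:R) / f n).

End Definitions.

(* Main.v *)
Require Import Defs.
From mathcomp Require Import all_boot all_order all_algebra.
From mathcomp Require Import all_classical all_reals all_analysis.
From mathcomp Require Import ring lra zify.
Import Order.TTheory GRing.Theory Num.Theory.
Import numFieldNormedType.Exports.
Local Open Scope ring_scope.

(** Write x = 2^n, w = W(log D), so that log D = w e^w.  Then
    D^(- log 2 / W(log D)) = exp(- e^w log 2), and after taking logarithms
    and multiplying by n, the inequality
    D^(- log 2 / W(log D)) < D^(-1/n) / f(n) becomes
      n log f(n) < (n log 2 - w) e^w,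
    the reverse inequality becoming the reverse one ([lt_iff_nlnf]).  The
    left side is a constant, called [nlnf n] below.  The right side tends to
    -oo with w, which gives (ii).  It is largest at w = n log 2 - 1, where it
    equals x / e, so (i) amounts to the purely arithmetical inequality
    n log f(n) < x / e ([nlnf_lt]); there is then room for an explicit interval
    of values of w to the right of the maximum, and w |-> exp(w e^w) carries it
    to an interval of values of D.

    For the arithmetical inequality, observe that
      n log f(n) = (sum over primes p <= x of log(x / p)) - log 2.
    When x is doubled this grows by the integral of pi(t) / t over [x, 2x].
    Replacing pi by pi(3x/2) and pi(2x) on the two parts of [x, 2x] bounds the
    growth by pi(3x/2) log(3/2) + pi(2x) log(4/3).  Primes
    above 30 are coprime to 30, whence pi(m) <= 4m/15 + 3 ([primepi_le]), and
    the growth is at most x / e as soon as x >= 64 ([nlnf_step]).  Since x / e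
    itself grows by x / e, induction starts at n = 6.  The inequality is tight
    for small n (5.63 against 5.89 for n = 4), and n = 4, 5, 6 are checked
    numerically from the list of primes. *)

(** * The functions pi and theta *)

Lemma primepiS m : primepi m.+1 = (primepi m + prime m.+1)%N.
Proof.
rewrite /primepi big_mkcond big_ord_recr -big_mkcond /=.
by case: (prime _).
Qed.

Lemma thetaS (R : realType) m :
  theta R m.+1 = theta R m + (if prime m.+1 then ln m.+1%:R else 0).
Proof. by rewrite /theta big_mkcond big_ord_recr -big_mkcond. Qed.

Lemma primepi_size m : primepi m = size [seq p <- iota 0 m.+1 | prime p].
Proof.
rewrite /primepi -(big_mkord prime (fun=> 1%N)) sum1_count size_filter.
by rewrite /index_iota subn0.
Qed.

Lemma theta_ln_prod (R : realType) m :
  theta R m = ln (\prod_(p <- [seq p <- iota 0 m.+1 | prime p]) (p%:R : R)).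
Proof.
rewrite /theta -(big_mkord prime (fun p => ln (p%:R : R))) -big_filter.
rewrite /index_iota subn0.
have : all prime [seq p <- iota 0 m.+1 | prime p] by rewrite filter_all.
elim: [seq p <- _ | _] => [|p s IH /=]; first by rewrite !big_nil ln1.
move=> /andP[p_pr s_pr]; rewrite !big_cons IH// lnM// posrE ?ltr0n ?prime_gt0//.
rewrite big_seq; apply: prodr_gt0 => q qs.
by rewrite ltr0n prime_gt0// (allP s_pr).
Qed.

(** Every prime counted by pi(b) - pi(a) exceeds a.  This is all that the
    estimate of the growth of [nlnf] uses about theta. *)
Lemma theta_ge_interval (R : realType) a b : (0 < a <= b)%N ->
  ((primepi b)%:R - (primepi a)%:R) * ln a%:R <= theta R b - theta R a.
Proof.
move=> /andP[a0 /subnK <-]; elim: (b - a)%N => [|k IH].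
  by rewrite add0n !subrr mul0r.
rewrite addSn primepiS thetaS natrD.
case: ifP => _ /=; last by rewrite !addr0.
have : ln a%:R <= ln (k + a).+1%:R :> R.
  by rewrite ler_ln ?posrE ?ltr0n// ler_nat; lia.
move: IH; lra.
Qed.

(** Coprimality to d is d-periodic, so moving the window by one trades an index
    for a congruent one. *)
Lemma sum_coprime_window d m : (0 < d)%N ->
  (\sum_(i < d) coprime d (m + i) = totient d)%N.
Proof.
move=> d0; elim: m => [|m <-].
  by rewrite totient_count_coprime big_mkord.
case: d d0 => // d _; rewrite big_ord_recr [RHS]big_ord_recl /= addnC.
congr (_ + _)%N.
  by rewrite addn0 addSn -addnS -coprime_modr modnDr coprime_modr.
by apply: eq_bigr => i _; rewrite /bump /= addnA addn1 addSn.
Qed.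

(** A prime greater than d cannot divide d, hence is coprime to it. *)
Lemma primepi_window d m : (0 < d <= m)%N ->
  (primepi (m + d) <= primepi m + totient d)%N.
Proof.
move=> /andP[d0 dm]; rewrite -(@sum_coprime_window d m.+1)//.
have : forall k,
    (primepi (m + k) <= primepi m + \sum_(i < k) coprime d (m.+1 + i))%N.
  elim=> [|k IH]; first by rewrite addn0 big_ord0 addn0.
  rewrite addnS primepiS big_ord_recr /= addnA leq_add// addSn.
  case: (boolP (prime _)) => // p_pr.
  by rewrite coprime_sym prime_coprime// gtnNdvd//; lia.
exact.
Qed.

(** Beyond 30, a window of length 30 has at most totient 30 = 8 primes: hence
    the slope 8/30; the constant is chosen to fit the values below 60, which
    start the induction. *)
Lemma primepi_le m : (15 * primepi m <= 4 * m + 45)%N.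
Proof.
elim/ltn_ind: m => m IH; case: (leqP 60 m) => [m60|].
  have := @primepi_window 30 (m - 30); rewrite subnK; last by lia.
  rewrite (_ : totient 30 = 8)%N// => W.
  have := IH (m - 30)%N; lia.
rewrite primepi_size => m60.
have /allP : all (fun m =>
    15 * size [seq p <- iota 0 m.+1 | prime p] <= 4 * m + 45)%N (iota 0 60).
  by vm_compute.
by apply; rewrite mem_iota.
Qed.

(** * Numerical bounds *)

Section Numerics.
Variable R : realType.

(** The margins below leave room for the crude bounds of e obtained from
    (1 + 1/64)^64 and (1 - 1/64)^64. *)
Lemma expR1_ge : 269 / 100 <= expR 1 :> R.
Proof.
have -> : 1 = 64%:R * 64%:R^-1 :> R by rewrite divff// pnatr_eq0.
rewrite expRM_natl.
apply: (@le_trans _ _ ((65 / 64) ^+ 64)); first by lra.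
rewrite lerXn2r ?nnegrE ?expR_ge0//.
by apply: le_trans (expR_ge1Dx _); lra.
Qed.

Lemma expRN1_gt : 4 / 11 < expR (- 1) :> R.
Proof.
have -> : -1 = 64%:R * - 64%:R^-1 :> R by rewrite mulrN divff// pnatr_eq0.
rewrite expRM_natl.
apply: (@lt_le_trans _ _ ((63 / 64) ^+ 64)); first by lra.
rewrite lerXn2r ?nnegrE ?expR_ge0//.
by apply: le_trans (expR_ge1Dx _); lra.
Qed.

(** Reduces an upper bound of a logarithm to an inequality between rational
    numbers, by way of exp(1) >= 2.69. *)
Lemma ln_le_ratio (q : R) k m : 0 < q -> (0 < m)%N ->
  q ^+ m <= (269 / 100) ^+ k -> ln q <= k%:R / m%:R.
Proof.
move=> q0 m0 qk; rewrite ler_pdivlMr ?ltr0n// mulr_natr -lnXn//.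
rewrite -ler_expR lnK ?posrE ?exprn_gt0//.
rewrite -[k%:R]mulr1 expRM_natl (le_trans qk)// lerXn2r ?nnegrE ?expR_ge0//.
exact: expR1_ge.
Qed.

(** The denominators come from (3/2)^17 and, below, (4/3)^24 being slightly
    less than e^7. *)
Lemma ln_3_2 : ln (3 / 2) <= 7%:R / 17%:R :> R.
Proof. by apply: ln_le_ratio => //; lra. Qed.

Lemma ln_4_3 : ln (4 / 3) <= 7%:R / 24%:R :> R.
Proof. by apply: ln_le_ratio => //; lra. Qed.

End Numerics.

(** * The inequality n log f(n) < 2^n / e *)

(** The product n log f(n), where the denominators of the exponent of f
    disappear and the terms become those of a sum of log(2^n / p). *)
Definition nlnf (R : realType) n : R :=
  (primepi (2 ^ n))%:R * (n%:R * ln 2) - theta R (2 ^ n) - ln 2.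

Section ArithmeticBound.
Variable R : realType.

(** Here exp(n log f(n)) is the quotient of 2^k by the product of the primes
    up to 2^n; as 4/11 < 1/e, it is enough to compare its 11-th power with
    exp(4 * 2^n). *)
Lemma nlnf_lt_of_primes n (s : seq nat) k :
  [seq p <- iota 0 (2 ^ n).+1 | prime p] = s ->
  (n * size s = k.+1)%N ->
  (2 ^+ k / \prod_(p <- s) p%:R) ^+ 11 <= (269 / 100) ^+ (4 * 2 ^ n) :> R ->
  nlnf R n < 2 ^+ n * expR (-1).
Proof.
move=> s_def nk le_pow; set P := \prod_(p <- s) _ in le_pow.
have P0 : 0 < P.
  rewrite /P -s_def big_seq prodr_gt0// => q.
  by rewrite mem_filter ltr0n => /andP[/prime_gt0].
have := @ln_le_ratio R (2 ^+ k / P) (4 * 2 ^ n) 11.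
rewrite divr_gt0 ?exprn_gt0// => /(_ isT isT le_pow).
rewrite ln_div ?posrE ?exprn_gt0// lnXn//.
have -> : nlnf R n = ln 2 *+ k - ln P.
  rewrite /nlnf primepi_size theta_ln_prod s_def -/P mulrA -natrM mulnC nk.
  rewrite -[ln 2 *+ k]mulr_natl -natr1; lra.
rewrite natrM natrX.
have : 2 ^+ n * (4 / 11) < 2 ^+ n * expR (-1) :> R.
  by rewrite ltr_pM2l ?exprn_gt0// expRN1_gt.
lra.
Qed.

Lemma nlnf4 : nlnf R 4 < 2 ^+ 4 * expR (-1).
Proof.
apply: (@nlnf_lt_of_primes _ [:: 2; 3; 5; 7; 11; 13]%N 23) => //.
by rewrite unlock /=; lra.
Qed.

Lemma nlnf5 : nlnf R 5 < 2 ^+ 5 * expR (-1).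
Proof.
apply: (@nlnf_lt_of_primes _
  [:: 2; 3; 5; 7; 11; 13; 17; 19; 23; 29; 31]%N 54) => //.
by rewrite unlock /= (_ : (4 * 2 ^ 5 = 128)%N) //; lra.
Qed.

Lemma nlnf6 : nlnf R 6 < 2 ^+ 6 * expR (-1).
Proof.
apply: (@nlnf_lt_of_primes _
  [:: 2; 3; 5; 7; 11; 13; 17; 19; 23; 29; 31; 37; 41; 43; 47; 53; 59; 61]%N
  107) => //.
by rewrite unlock /= (_ : (4 * 2 ^ 6 = 256)%N) //; lra.
Qed.

(** The growth from n to n + 1 is bounded by splitting the range of the new
    sum at x = 2^n, 3x/2 and 2x, where x = 2y below. *)
Lemma nlnf_step n : (6 <= n)%N -> nlnf R n.+1 - nlnf R n <= 2 ^+ n * expR (-1).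
Proof.
case: n => // n n5; set y := (2 ^ n)%N.
have y32 : (32 <= y)%N by exact: (@leq_pexp2l 2 5 n).
have y0 : 0 < y%:R :> R by rewrite ltr0n; lia.
rewrite /nlnf (expnS 2 n.+1) !(expnS 2 n) -/y exprS -natrX -/y.
have ln2y : ln (2 * y)%:R = n.+1%:R * ln 2 :> R.
  by rewrite /y -expnS natrX lnXn// mulr_natl.
have ln3y : ln (3 * y)%:R = ln (3 / 2) + n.+1%:R * ln 2 :> R.
  rewrite -ln2y -lnM ?posrE ?divr_gt0 ?ltr0n//; last by lia.
  by rewrite !natrM; congr ln; field.
have ln2E : ln 2 = ln (3 / 2) + ln (4 / 3) :> R.
  by rewrite -lnM ?posrE ?divr_gt0//; congr ln; field.
have h2 := @theta_ge_interval R (2 * y) (3 * y) ltac:(lia).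
have h1 := @theta_ge_interval R (3 * y) (2 * (2 * y)) ltac:(lia).
rewrite ln2y in h2; rewrite ln3y in h1.
have P3 := primepi_le (3 * y); have P4 := primepi_le (2 * (2 * y)).
have {}P3 : 15 * (primepi (3 * y))%:R <= 12 * y%:R + 45 :> R.
  by rewrite -!natrM -natrD ler_nat; lia.
have {}P4 : 15 * (primepi (2 * (2 * y)))%:R <= 16 * y%:R + 45 :> R.
  by rewrite -!natrM -natrD ler_nat; lia.
have p3 : (primepi (3 * y))%:R * ln (3 / 2) <=
    (primepi (3 * y))%:R * (7%:R / 17%:R) :> R.
  by rewrite ler_wpM2l// ln_3_2.
have p4 : (primepi (2 * (2 * y)))%:R * ln (4 / 3) <=
    (primepi (2 * (2 * y)))%:R * (7%:R / 24%:R) :> R.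
  by rewrite ler_wpM2l// ln_4_3.
have yE : y%:R * (4 / 11) <= y%:R * expR (-1) :> R.
  by rewrite ler_pM2l// ltW// expRN1_gt.
have y32R : 32 <= y%:R :> R by rewrite ler_nat.
move: h1 h2; rewrite -[n.+2%:R]natr1; move: (n.+1%:R) ln2E => N ->.
lra.
Qed.

Lemma nlnf_lt n : (4 <= n)%N -> nlnf R n < 2 ^+ n * expR (-1).
Proof.
elim/ltn_ind: n => -[//|n] IH.
rewrite leq_eqVlt => /predU1P[<-|]; first exact: nlnf4.
rewrite leq_eqVlt => /predU1P[<-|]; first exact: nlnf5.
rewrite leq_eqVlt => /predU1P[<-|]; first exact: nlnf6.
rewrite ltnS => n6.
have := IH n (leqnn _) (leq_trans _ n6); have := nlnf_step _ n6; rewrite exprS.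
move=> h1 /(_ isT); lra.
Qed.

End ArithmeticBound.

(** * The Lambert function *)

Section Lambert.
Variable R : realType.

Lemma wexp_lt (w v : R) : 0 <= w -> 0 <= v ->
  (w * expR w < v * expR v) = (w < v).
Proof.
have homo (a b : R) : 0 <= a -> a < b -> a * expR a < b * expR b.
  by move=> a0 ab; rewrite ltr_pM// ?expR_ge0// ltr_expR.
move=> w0 v0; apply/idP/idP; last exact: homo.
apply: contraTT; rewrite -!leNgt le_eqVlt => /predU1P[-> //|vw].
exact/ltW/homo.
Qed.

Lemma lambertW_spec (x : R) : 0 <= x ->
  0 <= lambertW x /\ lambertW x * expR (lambertW x) = x.
Proof.
move=> x0; set g := fun w : R => w * expR w.
have surj : set_surj [set w : R | 0 <= w]%classic
    [set x : R | 0 <= x]%classic g.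
  move=> y /= y0.
  have cg : {within `[0, y], continuous g}%classic.
    apply: continuous_subspaceT => z.
    apply: continuousM; [exact: cvg_id|exact: continuous_expR].
  have yg : y <= g y by rewrite /g ler_peMr// -expR0 ler_expR.
  have [] := IVT y0 cg (v := y).
    rewrite {1 3}/g mul0r (min_idPl _) ?(max_idPr _) ?y0 ?yg//;
      exact: (le_trans y0).
  by move=> c; rewrite in_itv /= => /andP[c0 _] gc; exists c.
split; last by apply: (surjpK _ surj); rewrite inE.
by apply: (@surjpinv_image_sub _ _ (fun=> 0) _ _ _ surj); exists x.
Qed.

Lemma lt_lambertW (w x : R) : 0 <= w -> 0 <= x ->
  (w < lambertW x) = (w * expR w < x).
Proof.
move=> w0 x0; have [W0 WE] := lambertW_spec _ x0.
by rewrite -[in RHS]WE wexp_lt.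
Qed.

Lemma lambertW_lt (w x : R) : 0 <= w -> 0 <= x ->
  (lambertW x < w) = (x < w * expR w).
Proof.
move=> w0 x0; have [W0 WE] := lambertW_spec _ x0.
by rewrite -[in RHS]WE wexp_lt.
Qed.

Lemma expR_wexp_lt_lambertW (w D : R) : 0 <= w -> expR (w * expR w) < D ->
  w < lambertW (ln D).
Proof.
move=> w0 wD; have D1 : 1 < D.
  by rewrite (le_lt_trans _ wD)// -expR0 ler_expR mulr_ge0// expR_ge0.
rewrite lt_lambertW ?ln_ge0// 1?ltW//.
by rewrite -ltr_expR lnK// posrE (lt_trans _ D1).
Qed.

Lemma lambertW_lt_expR_wexp (w D : R) : 0 <= w -> 1 <= D ->
  D < expR (w * expR w) -> lambertW (ln D) < w.
Proof.
move=> w0 D1 Dw.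
rewrite lambertW_lt ?ln_ge0//.
by rewrite -ltr_expR lnK// posrE (lt_le_trans _ D1).
Qed.

End Lambert.

(** * Reduction of the comparison to a function of W(log D) *)

Section Comparison.
Variable R : realType.

Lemma powR_lambertW (D : R) : 1 < D ->
  D `^ (- (ln 2 / lambertW (ln D))) = expR (- (ln 2 * expR (lambertW (ln D)))).
Proof.
move=> D1; have lnD := ln_gt0 D1; have [W0 WE] := lambertW_spec _ _ (ltW lnD).
have W_neq0 : lambertW (ln D) != 0.
  by apply: contraTneq lnD => W00; rewrite -WE W00 mul0r ltxx.
rewrite /powR gt_eqF ?(lt_trans _ D1)//; congr expR; rewrite -{2}WE.
by field.
Qed.

(** The exponent is written as that of [powR_lambertW] plus the quantity whose
    sign decides the comparison. *)
Lemma powR_div_f n (D : R) : (0 < n)%N -> 1 < D -> let w := lambertW (ln D) in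
  D `^ (- (1 / n%:R)) / f R n =
  expR (- (ln 2 * expR w) + ((n%:R * ln 2 - w) * expR w - nlnf R n) / n%:R).
Proof.
move=> n0 D1 w; have lnD := ln_gt0 D1.
have [W0 WE] := lambertW_spec _ _ (ltW lnD).
rewrite /powR gt_eqF ?(lt_trans _ D1)// /f -expRB /nlnf.
congr expR; rewrite -WE -/w.
by field; rewrite pnatr_eq0 -lt0n.
Qed.

Lemma lt_iff_nlnf n (D : R) : (0 < n)%N -> 1 < D -> let w := lambertW (ln D) in
  ((D `^ (- (ln 2 / w)) < D `^ (- (1 / n%:R)) / f R n) =
   (nlnf R n < (n%:R * ln 2 - w) * expR w)) *
  ((D `^ (- (1 / n%:R)) / f R n < D `^ (- (ln 2 / w))) =
   ((n%:R * ln 2 - w) * expR w < nlnf R n)).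
Proof.
move=> n0 D1 w; rewrite powR_lambertW// powR_div_f// !ltr_expR -/w.
rewrite ltrDl gtrDl pmulr_lgt0 ?pmulr_llt0 ?invr_gt0 ?ltr0n//.
by rewrite subr_gt0 subr_lt0.
Qed.

Lemma B1E (eps D : R) : 0 < D ->
  B1 eps D =
  131 / 100 / pi * eps * D `^ (1 / 2 - eps) * D `^ (- (ln 2 / lambertW (ln D))).
Proof.
by move=> D0; rewrite /B1 powRD ?(gt_eqF D0) ?implybT// !mulrA.
Qed.

Lemma B2E n (eps D : R) : 0 < D ->
  B2 n eps D =
  131 / 100 / pi * eps * D `^ (1 / 2 - eps) * (D `^ (- (1 / n%:R)) / f R n).
Proof.
by move=> D0; rewrite /B2 powRD ?(gt_eqF D0) ?implybT// !mulrA.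
Qed.

End Comparison.

(** * The comparison of the two bounds *)

Theorem theorem3 (R : realType) (n : nat) (hn : (4 <= n)%N) :
  (* the two inequalities are equivalent, for each D > 1 and each eps *)
  (forall eps D : R, 0 < eps < 1 / 2 -> 1 < D ->
     (B1 eps D < B2 n eps D <->
      D `^ (- (ln 2 / lambertW (ln D))) < D `^ (- (1 / n%:R)) / f R n) /\
     (B2 n eps D < B1 eps D <->
      D `^ (- (1 / n%:R)) / f R n < D `^ (- (ln 2 / lambertW (ln D))))) /\
  (* (i) *)
  (exists a b : R, 1 <= a /\ a < b /\
     forall D : R, a < D < b ->
       (forall eps : R, 0 < eps < 1 / 2 -> B1 eps D < B2 n eps D) /\
       D `^ (- (ln 2 / lambertW (ln D))) < D `^ (- (1 / n%:R)) / f R n) /\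
  (* (ii) *)
  (exists D0 : R, forall D : R, 1 < D -> D0 < D ->
       (forall eps : R, 0 < eps < 1 / 2 -> B2 n eps D < B1 eps D) /\
       D `^ (- (1 / n%:R)) / f R n < D `^ (- (ln 2 / lambertW (ln D)))).
Proof.
have equiv (eps D : R) : 0 < eps < 1 / 2 -> 1 < D ->
    (B1 eps D < B2 n eps D <->
      D `^ (- (ln 2 / lambertW (ln D))) < D `^ (- (1 / n%:R)) / f R n) /\
    (B2 n eps D < B1 eps D <->
      D `^ (- (1 / n%:R)) / f R n < D `^ (- (ln 2 / lambertW (ln D)))).
  move=> /andP[eps0 _] D1; have D0 := lt_trans ltr01 D1.
  have C0 : 0 < 131 / 100 / pi * eps * D `^ (1 / 2 - eps).
    by rewrite !(mulr_gt0, divr_gt0) ?invr_gt0 ?pi_gt0 ?powR_gt0.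
  by rewrite B1E// B2E// !(ltr_pM2l C0).
have n0 : (0 < n)%N by apply: leq_trans hn.
have nln2_gt1 : 1 < n%:R * ln 2 :> R.
  rewrite mulr_natl -lnXn// -ltr_expR lnK ?posrE ?exprn_gt0//.
  apply: (@lt_le_trans _ _ (2 ^+ 4)); last by rewrite ler_weXn2l// ler1n.
  have := expRN1_gt R; rewrite expRN.
  rewrite -[X in _ < X]mul1r ltr_pdivlMr ?expR_gt0//; lra.
split; [exact: equiv|split].
  (* w1 maximizes (n log 2 - w) e^w, with maximum E = 2^n / e. *)
  pose w1 : R := n%:R * ln 2 - 1; pose E := expR w1.
  have E0 : 0 < E := expR_gt0 _.
  have nlnfE : nlnf R n < E.
    by rewrite /E /w1 expRD mulr_natl -lnXn// lnK ?posrE ?exprn_gt0// nlnf_lt.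
  (* To the right of w1 the factor e^w only grows, so the expression exceeds M
     as long as n log 2 - w > M / E, that is, w < w2.  Taking M >= 0 makes
     n log 2 - w positive there. *)
  pose M := Num.max 0 (nlnf R n).
  have ME : M < E by rewrite gt_max E0.
  pose w2 := w1 + (1 - M / E).
  have w1_ge0 : 0 <= w1 by rewrite subr_ge0 ltW.
  have w12 : w1 < w2 by rewrite ltrDl subr_gt0 ltr_pdivrMr// mul1r.
  have a1 : 1 <= expR (w1 * expR w1).
    by rewrite -expR0 ler_expR mulr_ge0// expR_ge0.
  exists (expR (w1 * expR w1)), (expR (w2 * expR w2)).
  split=> //; split.
    by rewrite ltr_expR wexp_lt// (le_trans w1_ge0)// ltW.
  move=> D /andP[D1 D2]; have gtD1 := le_lt_trans a1 D1.
  have lt12 : D `^ (- (ln 2 / lambertW (ln D))) < D `^ (- (1 / n%:R)) / f R n.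
    have /= -> := lt_iff_nlnf _ _ D n0 gtD1.
    have w2_ge0 := le_trans w1_ge0 (ltW w12).
    have := lambertW_lt_expR_wexp _ w2 D w2_ge0 (ltW gtD1) D2.
    have := expR_wexp_lt_lambertW _ w1 D w1_ge0 D1.
    set w := lambertW _ => w1w ww2.
    have M_lt : M < (n%:R * ln 2 - w) * E.
      by rewrite -ltr_pdivrMr//; move: ww2; rewrite /w2 /w1; lra.
    have Ew : E <= expR w by rewrite ler_expR ltW.
    have : 0 < (n%:R * ln 2 - w) * E.
      by apply: le_lt_trans M_lt; rewrite le_max lexx.
    rewrite pmulr_lgt0// => nw; apply: (@le_lt_trans _ _ M).
      by rewrite le_max lexx orbT.
    by apply: (lt_le_trans M_lt); rewrite ler_pM2l.
  by split=> // eps heps; apply/(equiv eps D heps gtD1).1.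
(* Beyond w0 the factor n log 2 - w is below -|n log f(n)|, and e^w >= 1. *)
set w0 : R := n%:R * ln 2 + `|nlnf R n|.
have w0_ge0 : 0 <= w0 by rewrite addr_ge0// (le_trans _ (ltW nln2_gt1)).
exists (expR (w0 * expR w0)) => D D1 D0.
have lt21 : D `^ (- (1 / n%:R)) / f R n < D `^ (- (ln 2 / lambertW (ln D))).
  have /= -> := lt_iff_nlnf _ _ D n0 D1.
  have := expR_wexp_lt_lambertW _ w0 D w0_ge0 D0.
  set w := lambertW _ => w0w.
  apply: (@lt_le_trans _ _ (- `|nlnf R n|)); last first.
    by rewrite lerNl -normrN ler_norm.
  have e1 : 1 <= expR w by rewrite -expR0 ler_expR (le_trans w0_ge0)// ltW.
  have g0 := normr_ge0 (nlnf R n).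
  move: w0w; rewrite /w0; nra.
by split=> // eps heps; apply/(equiv eps D heps D1).2.
Qed.
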